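(* The random walk on $S_n$ with increment transition measure $p_n(\mathrm{id},\cdot)$ is not reversible.
   Context: A permutation $\sigma\in S_n$ is viewed as a deck of cards numbered $1,\dots,n$ laid out in a row, where $\sigma_j$ is the number of the card in the $j$-th position from the left. The card-cyclic to random insertion shuffle removes and then randomly reinserts each of the $n$ cards exactly once (each reinsertion being in a uniformly random one of the $n$ positions, independently of the others), the removal and reinsertion being performed one card at a time in the original left-to-right order of the cards in the starting state. $p_n(\sigma,\tau)$ denotes the probability that the deck ends up in state $\tau$ after one such shuffle started from state $\sigma$; $\mathrm{id}$ is the identity (cards in increasing order from left to right). The random walk in question is the Markov chain on $S_n$ with transition probabilities $p_n(\sigma,\tau)$; its $m$-step distribution from $\mathrm{id}$ is the $m$-fold convolution of $p_n(\mathrm{id},\cdot)$. Reversibility of this walk amounts to the equality $p_n(\mathrm{id},\sigma)=p_n(\mathrm{id},\sigma^{-1})$ for all $\sigma\in S_n$.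
   Formalization: The formal theorem assumes n ≥ 3; for n = 1 and n = 2 every permutation is its own inverse, so p_n(id,σ) = p_n(id,σ⁻¹) and the walk is reversible, making the unrestricted claim false there. *)

(* Defs.v *)
From mathcomp Require Import all_boot all_order all_fingroup all_algebra.

Set Implicit Arguments.
Unset Strict Implicit.
Unset Printing Implicit Defensive.

Import GRing.Theory.
Local Open Scope ring_scope.

(* Cards and positions are numbered from 0 rather than from 1: the deck
   sigma : 'S_n has the card sigma j at position j, so that, read from left to
   right, it is the sequence [codom sigma]. *)

Definition reinsert (T : eqType) (c : T) (k : nat) (s : seq T) : seq T :=
  take k (rem c s) ++ c :: drop k (rem c s).

(* The cards are handled in the order sigma 0, sigma 1, ... in which they lie
   in the starting deck, whatever the current deck is; the card sigma j goes
   back at position k j of the resulting deck. *)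
Definition shuffle (n : nat) (sigma : 'S_n) (k : {ffun 'I_n -> 'I_n}) :
    seq 'I_n :=
  foldl (fun s j => reinsert (sigma j) (k j) s) (codom sigma) (enum 'I_n).

(* The probability that the shuffle takes sigma to tau, the n insertion
   positions k j being independent and uniform on 'I_n. *)
Definition p (R : realFieldType) (n : nat) (sigma tau : 'S_n) : R :=
  \sum_(k : {ffun 'I_n -> 'I_n} | shuffle sigma k == codom tau)
    \prod_(j < n) n%:R^-1.

Definition distribution (R : realFieldType) (T : finType) (pi : T -> R) : Prop :=
  (forall x, 0 <= pi x) /\ \sum_x pi x = 1.

(* Detailed balance with respect to some probability distribution; summing it
   over x shows that pi is stationary when P is stochastic. *)
Definition reversible (R : realFieldType) (T : finType) (P : T -> T -> R) : Prop :=
  exists2 pi : T -> R, distribution pi &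
    forall x y, pi x * P x y = pi y * P y x.

Lemma shuffle_transl n (sigma : 'S_n) k :
  shuffle sigma k = map sigma (shuffle 1%g k).
Proof.
have map_rem (c : 'I_n) s : map sigma (rem c s) = rem (sigma c) (map sigma s).
  by elim: s => //= x s IHs; rewrite (inj_eq perm_inj); case: eqP => //= _; rewrite IHs.
rewrite /shuffle; have ->: codom sigma = map sigma (codom (1%g : 'S_n)).
  by rewrite !codomE -[RHS]map_comp; apply: eq_map => j /=; rewrite perm1.
elim: (enum _) (codom _) => //= j e IHe s.
by rewrite -IHe /reinsert map_cat map_take /= map_drop perm1 map_rem.
Qed.

(* The chain with transition probabilities p is the random walk with increment
   measure p 1 (the product of 'S_n is such that (tau * sigma^-1) j is
   sigma^-1 (tau j)). *)
Lemma p_transl (R : realFieldType) n (sigma tau : 'S_n) :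
  p R sigma tau = p R 1%g (tau * sigma^-1)%g.
Proof.
rewrite /p; apply: eq_bigl => k; rewrite shuffle_transl.
have ->: codom tau = map sigma (codom (tau * sigma^-1)%g).
  by rewrite !codomE -[RHS]map_comp; apply: eq_map => j /=; rewrite permM permKV.
by rewrite (inj_eq (inj_map perm_inj)).
Qed.

(* Main.v *)
(** Detailed balance, summed over the states, makes the increment measure
    invariant under inversion, so card i would end at position j as often as
    card j ends at position i.  Let a and b be the last two cards.  Card b is
    reinserted last, so it ends at position a for n^(n-1) of the n^n choices of
    insertion positions.  Card a ends at position b exactly when b is not
    reinserted at the end and a is reinserted either at the end, or just before
    b while b still lies at the end: this gives
    (n-1) (n^(n-2) + (n-1)^(n-2)) choices.  The first number is divisible by n,
    the second one is congruent to 1 or -1 modulo n when n > 2. *)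
Require Import Defs.
From mathcomp Require Import all_boot all_order all_fingroup all_algebra.

Set Implicit Arguments.
Unset Strict Implicit.
Unset Printing Implicit Defensive.

Import GRing.Theory Num.Theory.

(** * Effect of reinsertions on the last card of a sequence *)

Section Reinsert.

Variables (T : eqType) (x : T).
Implicit Types (c d : T) (s e : seq T).

Lemma last_rem c s : last x s != c -> last x (rem c s) = last x s.
Proof.
elim: s x => //= y s IHs z; case: (y =P c) => [-> | _] /=; last exact: IHs.
by case: s {IHs} => //=; rewrite eqxx.
Qed.

Lemma perm_reinsert c k s : c \in s -> perm_eq (reinsert c k s) s.
Proof.
move=> cs; rewrite perm_sym (perm_trans (perm_to_rem cs)) //.
by rewrite /reinsert perm_sym perm_catC /= perm_cons perm_catC cat_take_drop.
Qed.

Lemma last_reinsert_ge c k s :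
  size (rem c s) <= k -> last x (reinsert c k s) = c.
Proof. by move=> le_k; rewrite /reinsert drop_oversize // last_cat. Qed.

Lemma last_reinsert_lt c k s :
  k < size (rem c s) -> last x (reinsert c k s) = last x (rem c s).
Proof.
move=> lt_k; rewrite -[in RHS](cat_take_drop k (rem c s)) /reinsert !last_cat /=.
by rewrite (drop_nth c) //.
Qed.

Lemma nth_reinsert c k s : k <= size (rem c s) -> nth x (reinsert c k s) k = c.
Proof. by move=> le_k; rewrite /reinsert nth_cat size_takel // ltnn subnn. Qed.

Lemma perm_foldl_reinsert (k : T -> nat) e s : {subset e <= s} ->
  perm_eq (foldl (fun s c => reinsert c (k c) s) s e) s.
Proof.
elim: e s => //= c e IHe s sub_es.
have perm_s := perm_reinsert (k c) (sub_es c (mem_head c e)).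
apply: (perm_trans _ perm_s); apply: IHe => d de.
by rewrite (perm_mem perm_s) sub_es // inE de orbT.
Qed.

(* A card reinserted behind the initial last card stays behind it, since no
   card is moved twice. *)
Lemma last_foldl_reinsert (k : T -> nat) e s :
    uniq e -> {subset e <= s} -> last x s \notin e ->
  let l := last x (foldl (fun s c => reinsert c (k c) s) s e) in
  l \in last x s :: e /\ (l == last x s) = all (fun c => k c < (size s).-1) e.
Proof.
elim: e s => [|c e IHe] s /=; first by rewrite mem_head eqxx.
case/andP=> ce Ue sub_es; rewrite inE negb_or => /andP[lc le].
have cs : c \in s by rewrite sub_es ?mem_head.
have perm_s := perm_reinsert (k c) cs.
have sub_es1 : {subset e <= reinsert c (k c) s}.
  by move=> d de; rewrite (perm_mem perm_s) sub_es // inE de orbT.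
have [lt_k | ge_k] := ltnP (k c) (size s).-1.
  have l1 : last x (reinsert c (k c) s) = last x s.
    by rewrite last_reinsert_lt ?size_rem // last_rem.
  have [] := IHe _ Ue sub_es1; rewrite l1 // (perm_size perm_s).
  move=> lin ->; split=> //.
  by move: lin; rewrite !inE => /orP[] ->; rewrite ?orbT.
have l1 : last x (reinsert c (k c) s) = c by rewrite last_reinsert_ge ?size_rem.
(* Here [c] has become the last card, so induction puts the final last card in [c :: e], which does
   not contain [last x s]. *)
have [] := IHe _ Ue sub_es1; rewrite l1 // => lin _.
split; first by rewrite inE lin orbT.
apply/eqP => eq_l; move: lin.
by rewrite eq_l inE (negPf lc) (negPf le).
Qed.

(** Card [a] gets last either by going to the end, or by going just before a final [b] that is then
    taken away. Putting [b] back at the end would spoil both. *)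
Lemma last_reinsert2 a b i j s :
    uniq s -> a != b -> a \in s -> b \in s -> last x s != a ->
    i < size s -> j < size s ->
  (last x (reinsert b j (reinsert a i s)) == a) =
  (j < (size s).-1) &&
    ((i == (size s).-1) || (i == (size s).-2) && (last x s == b)).
Proof.
move=> Us ab as_ bs la lt_i lt_j.
have perm_s := perm_reinsert i as_.
have bs1 : b \in reinsert a i s by rewrite (perm_mem perm_s).
have szr : size (rem b (reinsert a i s)) = (size s).-1.
  by rewrite size_rem // (perm_size perm_s).
have sza : size (rem a s) = (size s).-1 by rewrite size_rem.
have [ltj | gej] /= := ltnP j (size s).-1; last first.
  by rewrite last_reinsert_ge ?szr // eq_sym (negPf ab).
rewrite last_reinsert_lt ?szr //.
have [-> | ni] := eqVneq i (size s).-1.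
  by rewrite last_rem last_reinsert_ge ?sza ?eqxx.
have lti : i < (size s).-1.
  by rewrite ltn_neqAle ni -ltnS prednK ?(leq_trans _ lt_i).
have l1 : last x (reinsert a i s) = last x s.
  by rewrite last_reinsert_lt ?sza // last_rem.
have [lb | nlb] := eqVneq (last x s) b; last first.
  by rewrite last_rem ?l1 // (negPf la) andbF.
rewrite andbT /=.
have lb' : last x (rem a s) = b by rewrite last_rem.
have rs0 : rem a s != [::] by rewrite -size_eq0 sza -lt0n (leq_trans _ lti).
(* In the remaining case [b] lies at the end and [a] goes somewhere before it, that is, into [t]. *)
have [t def_t] : exists t, rem a s = rcons t b.
  by move: lb' rs0; case/lastP: (rem a s) => // t y; rewrite last_rcons => -> _; exists t.
have szt : size t = (size s).-2 by rewrite -sza def_t size_rcons.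
have : uniq (rcons t b) by rewrite -def_t rem_uniq.
rewrite rcons_uniq => /andP[bt Ut].
have at_ : a \notin t.
  apply: contraTN Us => at_; apply/negP => Us; have := mem_rem_uniqF a Us.
  by rewrite def_t mem_rcons inE at_ orbT.
have lei : i <= size t by rewrite szt -ltnS prednK ?(leq_trans _ lti).
rewrite /reinsert def_t -cats1 takel_cat // drop_cat.
(* At the boundary [i = size t] both branches are [[:: b]]. *)
have -> : (if i < size t then drop i t ++ [:: b] else drop (i - size t) [:: b])
        = drop i t ++ [:: b].
  case: ltnP => // ge_i; have -> : i = size t by apply/eqP; rewrite eqn_leq lei.
  by rewrite subnn drop0 drop_size.
rewrite -cat_cons catA remE.
(* What is left once [b] is removed: [t] with [a] inserted at position [i]. *)
set u := take i t ++ a :: drop i t.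
have bu : b \notin u.
  rewrite /u mem_cat in_cons orbCA -mem_cat cat_take_drop negb_or eq_sym ab.
  exact: bt.
rewrite index_cat (negPf bu) /= eqxx addn0 take_size_cat // drop_oversize ?cats0; last first.
  by rewrite size_cat addn1.
rewrite /u last_cat /= -szt.
have [-> | nei] := eqVneq i (size t); first by rewrite drop_size /= eqxx.
have lt_it : i < size t by rewrite ltn_neqAle nei.
(* For [i < size t] the last card of [u] comes from [t], which does not contain [a]. *)
apply/negbTE; apply: contraNneq at_ => <-.
rewrite (drop_nth x) //=; apply: (@mem_drop i).
by rewrite (drop_nth x lt_it) mem_last.
Qed.

End Reinsert.

(** * Final decks as permutations, and the consequence of reversibility *)

Section Deck.

Variable n : nat.
Implicit Types (k : {ffun 'I_n -> 'I_n}) (tau : 'S_n).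

Lemma shuffle1 k :
  shuffle 1 k = foldl (fun s j => reinsert j (k j) s) (enum 'I_n) (enum 'I_n).
Proof.
rewrite /shuffle.
have -> : codom (1%g : 'S_n) = enum 'I_n.
  by rewrite codomE -[RHS]map_id; apply: eq_map => j; rewrite perm1.
(* Occurrences 2 and 4 are the cards still to be handled; the other two are decks, which vary in the
   induction. *)
move: {2 4}(enum _) => e; elim: e (enum _) => //= j e IHe s.
by rewrite perm1 IHe.
Qed.

Lemma shuffle_codom k : {tau : 'S_n | shuffle 1 k == codom tau}.
Proof.
apply: sigW; have : perm_eq (shuffle 1 k) (ord_tuple n).
  by rewrite shuffle1 perm_foldl_reinsert // val_ord_tuple.
case/tuple_permP=> tau ->; exists tau; rewrite codomE.
by apply/eqP; apply: eq_map => j; rewrite tnth_ord_tuple.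
Qed.

Definition endperm k : 'S_n := sval (shuffle_codom k).

Lemma codom_endperm k : codom (endperm k) = shuffle 1 k.
Proof. by rewrite (eqP (svalP (shuffle_codom k))). Qed.

Lemma codom_perm_inj : injective (fun tau => codom tau).
Proof.
move=> s t; rewrite !codomE => /eq_in_map st; apply/permP => j.
by apply: st; rewrite mem_enum.
Qed.

Lemma endpermE k j : nth j (shuffle 1 k) j = endperm k j.
Proof.
by rewrite -codom_endperm codomE (nth_map j) ?size_enum_ord // nth_ord_enum.
Qed.

Variable R : realFieldType.

(** Each choice of insertion positions has the same weight and leads to exactly one final deck, so
    probabilities reduce to counts of choices. *)
Lemma sum_p1 (A : pred 'S_n) :
  (\sum_(tau | A tau) p R 1 tau = #|[pred k | A (endperm k)]|%:R * n%:R^-1 ^+ n)%R.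
Proof.
rewrite -sum1_card natr_sum mulr_suml (partition_big endperm A) //=.
apply: eq_bigr => tau At; rewrite /p; apply: eq_big => [k | k _].
  rewrite -codom_endperm (inj_eq codom_perm_inj).
  by rewrite inE; case: eqP => [-> | _]; rewrite ?At ?andbF.
by rewrite prodr_const card_ord mul1r.
Qed.

Lemma reversible_p_inv : reversible (@p R n) ->
  forall tau, p R 1 tau = p R 1 (tau^-1)%g.
Proof.
case=> pi [_ pi1] bal tau.
(* The mass 1 of [pi] is summed over [x] on the left and over [tau * x] on the right. Detailed
   balance between [x] and [tau * x], whose increments are [tau] and [tau^-1], then matches the
   terms. *)
rewrite -[LHS]mul1r -[RHS]mul1r -pi1 [in RHS](reindex_inj (mulgI tau)) !mulr_suml.
apply: eq_bigr => x _; have := bal x (tau * x)%g.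
by rewrite (p_transl R x) (p_transl R _ x) mulgK invMg mulKVg.
Qed.

End Deck.

(** * Counting the choices that send one of the last two cards to the position of the other *)

Section LastTwoCards.

Variable m : nat.
Local Notation n := m.+2.
Local Notation b := (@ord_max m.+1).
Local Notation a := (widen_ord (leqnSn m.+1) (@ord_max m)).
Local Notation w := (fun j : 'I_m => widen_ord (leqnSn m.+1) (widen_ord (leqnSn m) j)).
Implicit Type k : {ffun 'I_n -> 'I_n}.

Lemma enum_last2 : enum 'I_n = rcons (rcons (map w (enum 'I_m)) a) b.
Proof. by rewrite enum_ordSr enum_ordSr map_rcons -map_comp. Qed.

(** No card is moved after [b], so [b] stays where it is put. *)
Lemma endperm_last k : endperm k (k b) = b.
Proof.
rewrite -endpermE shuffle1 {2}enum_last2 foldl_rcons nth_reinsert //.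
set s := foldl _ _ _.
have perm_s : perm_eq s (enum 'I_n).
  by apply: perm_foldl_reinsert => j _; rewrite mem_enum.
by rewrite size_rem ?(perm_mem perm_s) ?mem_enum // (perm_size perm_s) size_enum_ord -ltnS.
Qed.

(** After the first [m] reinsertions, [b] is still last exactly when none of them was at the end;
    [last_reinsert2] describes the two that follow. *)
Lemma endperm_before_last k : (endperm k b == a) =
  (k b != b) && ((k a == b) || (k a == a) && [forall j : 'I_m, k (w j) != b]).
Proof.
have neb (j : 'I_n) : (j < m.+1) = (j != b).
  by rewrite -val_eqE /= ltn_neqAle -ltnS ltn_ord andbT.
have -> : endperm k b = last a (shuffle 1 k).
  by rewrite -codom_endperm codomE enum_last2 map_rcons last_rcons.
have := enum_uniq 'I_n.
rewrite shuffle1 {3}enum_last2 !foldl_rcons {1}enum_last2 !rcons_uniq.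
rewrite mem_rcons inE negb_or -andbA => /and4P[ba be ae Ue].
set e := map w _ in be ae Ue *; set s := foldl _ _ _.
have last0 : last a (enum 'I_n) = b by rewrite enum_last2 last_rcons.
have sub_e : {subset e <= enum 'I_n} by move=> j _; rewrite mem_enum.
have [] := last_foldl_reinsert (x := a) (fun j => k j : nat) Ue sub_e.
  by rewrite last0.
rewrite last0 -/s size_enum_ord => lin ls.
have perm_s : perm_eq s (enum 'I_n) by exact: perm_foldl_reinsert.
have sz : size s = n by rewrite (perm_size perm_s) size_enum_ord.
rewrite last_reinsert2 ?sz ?ltn_ord ?(perm_uniq perm_s) ?enum_uniq //.
- rewrite /= neb ls all_map; congr (_ && (_ || _ && _)).
  apply/allP/forallP => [h j | h j _] /=.
    by rewrite -neb; apply: h; rewrite mem_enum.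
  by rewrite neb.
- by rewrite eq_sym.
- by rewrite (perm_mem perm_s) mem_enum.
- by rewrite (perm_mem perm_s) mem_enum.
(* The last card of [s] lies in [b :: e], hence is not [a]. *)
apply: contraTneq lin => ->; rewrite inE negb_or ae andbT eq_sym; exact: ba.
Qed.

(** The three conditions bear on disjoint sets of arguments of [k], so these functions form a
    [family], whose cardinal is a product. *)
Lemma card_last2 (P Q S : pred 'I_n) :
  #|[pred k : {ffun 'I_n -> 'I_n} | [&& P (k b), Q (k a) & [forall j : 'I_m, S (k (w j))]]]| =
  (#|S| ^ m * #|Q| * #|P|)%N.
Proof.
pose F (j : 'I_n) : pred 'I_n :=
  if j == b then P else if j == a then Q else S.
have Fb : F b = P by rewrite /F eqxx.
have Fa : F a = Q by rewrite /F eqxx -val_eqE /= ltn_eqF.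
have Fw j : F (w j) = S.
  by rewrite /F -!val_eqE /= !ltn_eqF // ltnS ltnW.
transitivity #|(family F : simpl_pred {ffun 'I_n -> 'I_n})|.
  apply: eq_card => k; rewrite !inE; apply/and3P/forallP => [[Pb Qa /forallP Sw] j | h].
    suff: F j (k j) by [].
    have: j \in enum 'I_n by rewrite mem_enum.
    rewrite enum_last2 mem_rcons in_cons mem_rcons in_cons => /or3P[/eqP->|/eqP->|/mapP[i _ ->]].
    - by rewrite Fb.
    - by rewrite Fa.
    by rewrite Fw; apply: Sw.
  have {}h j : F j (k j) := h j.
  split; first by have := h b; rewrite Fb.
    by have := h a; rewrite Fa.
  by apply/forallP=> j; have := h (w j); rewrite Fw.
rewrite card_family foldrE big_map big_enum /= !big_ord_recr /= Fb Fa.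
by under eq_bigr => j _ do rewrite Fw; rewrite prod_nat_const card_ord.
Qed.

Lemma card_endperm_last : #|[pred k | endperm k a == b]| = (n ^ m.+1)%N.
Proof.
have := card_last2 (pred1 a) predT predT.
rewrite card1 cardT size_enum_ord muln1 -expnSr => <-.
apply: eq_card => k; rewrite !inE /=.
have -> : (endperm k a == b) = (k b == a).
  by rewrite -[X in _ == X](endperm_last k) (inj_eq perm_inj) eq_sym.
by case: eqP => //= _; apply/esym/forallP.
Qed.

Lemma card_endperm_before_last :
  #|[pred k | endperm k b == a]| = (m.+1 * (n ^ m + m.+1 ^ m))%N.
Proof.
have := card_last2 (predC1 b) (pred1 a) (predC1 b).
have := card_last2 (predC1 b) (pred1 b) predT.
rewrite cardC1 !card1 cardT size_enum_ord /= !muln1 => c1 c2.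
(* The two terms count the choices with [k a = b] and those with [k a = a]; these are disjoint
   because [a] and [b] differ. *)
rewrite mulnC mulnDl -c1 -c2 -cardUI.
rewrite [X in (_ + X)%N]eq_card0 ?addn0; last first.
  move=> k; rewrite !inE /=; apply/negP.
  case/andP=> /and3P[_ /eqP kab _] /and3P[_].
  by rewrite kab -val_eqE /= gtn_eqF.
apply: eq_card => k; rewrite !inE /= endperm_before_last.
have -> : [forall j : 'I_m, true] by apply/forallP.
by rewrite andbT -andb_orr.
Qed.

Lemma card_endperm_neq : 0 < m ->
  #|[pred k | endperm k a == b]| != #|[pred k | endperm k b == a]|.
Proof.
move=> m_gt0; rewrite card_endperm_last card_endperm_before_last.
apply: contraTneq (dvdn_exp (ltn0Sn m) (dvdnn n)) => ->.
(* Since [m.+1] is coprime to [n = m.+2], divisibility by [n] passes to the second factor, then to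
   [m.+1 ^ m], which is coprime to [n]. Dropping [n ^ m] uses [0 < m]; for [m = 0] both counts equal
   2. *)
rewrite Gauss_dvdr ?coprimeSn // dvdn_addr; last exact: dvdn_exp.
have: coprime n (m.+1 ^ m) by rewrite coprimeXr ?coprimeSn.
by rewrite /coprime; apply: contraL => /gcdn_idPl ->.
Qed.

End LastTwoCards.

Theorem corollary8 (R : realFieldType) (n : nat) (hn : (2 < n)%N) :
  ~ @reversible R 'S_n (@p R n).
Proof.
case: n hn => [|[|m]] // m_gt0 /reversible_p_inv p_inv.
set b := @ord_max m.+1; set a := widen_ord (leqnSn m.+1) (@ord_max m).
have [/negP] := card_endperm_neq m_gt0; apply.
have : (\sum_(tau : 'S_m.+2 | tau a == b) p R 1 tau =
        \sum_(tau : 'S_m.+2 | tau b == a) p R 1 tau)%R.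
  (* Inversion exchanges the events [tau a = b] and [tau b = a]. *)
  rewrite (reindex_inj invg_inj) /=.
  by apply: eq_big => [tau | tau _]; rewrite -?p_inv // (canF_eq (permKV tau)) eq_sym.
rewrite !sum_p1 => /mulIf eq_card; rewrite -(eqr_nat R); apply/eqP/eq_card.
by rewrite expf_neq0 // invr_eq0 pnatr_eq0.
Qed.
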